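(* In the known-preferences setting, the Mirror mechanism is universally group-strategyproof and has an approximation ratio of $4/3$.
   Context: Setting: a finite nonempty set $N$ of $n$ agents and two facilities $1,2$. Agent $i$ has a position $x_i\in[0,1]$ and an approval preference $t_i=(t_{i1},t_{i2})\in\{0,1\}^2$ ($t_{ij}=1$ iff $i$ approves facility $j$); every agent approves at least one facility. An instance is $I=(\mathbf{x},\mathbf{t})$. If facility $j$ is located at $y\in[0,1]$ (a single facility is located), agent $i$ has utility $u_i(j,y|I)=t_{ij}(1-|x_i-y|)$; the social welfare is $W(j,y|I)=\sum_{i\in N}u_i(j,y|I)$ and $W^*(I)=\max_{(j,y)}W(j,y|I)$. A deterministic mechanism maps each instance to an outcome $(j,y)\in\{1,2\}\times[0,1]$; a randomized mechanism maps each instance to a probability distribution over outcomes, and is evaluated by its expected social welfare. The approximation ratio of a mechanism $M$ is $\rho(M)=\sup_I W^*(I)/W(M(I)|I)$ over all instances, where $W(M(I)|I)$ is the (expected) social welfare. In the known-preferences setting preferences are public and agents can misreport only positions. A deterministic mechanism $M$ is group-strategyproof if no nonempty coalition of agents can jointly misreport their positions so that the utility of every coalition member (computed with true data) strictly increases. A randomized mechanism is universally group-strategyproof if it is a probability distribution over deterministic group-strategyproof mechanisms. Mirror mechanism: let $n_j$ be the number of agents that approve facility $j\in\{1,2\}$; assume $n_1\ge n_2$ (otherwise swap the roles of the facilities). Let $\alpha=\frac{3n_1-2n_2}{4n_1-2n_2}$. Choose facility $1$ with probability $\alpha$ and facility $2$ with probability $1-\alpha$. Locate the chosen facility at the position of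 the median agent among the agents that approve it (if their number is even, a fixed one of the two middle agents in the order of positions; if nobody approves it, at an arbitrary fixed location). *)

(* Defs.v *)
From HB Require Import structures.
From mathcomp Require Import all_boot all_order all_algebra.
From mathcomp Require Import all_classical all_reals all_analysis.
From mathcomp Require Import ring lra.

Set Implicit Arguments.
Unset Strict Implicit.
Unset Printing Implicit Defensive.

Import Order.TTheory GRing.Theory Num.Theory.
Import numFieldNormedType.Exports.

Local Open Scope classical_set_scope.
Local Open Scope ring_scope.

(* Facility 1 is [true], facility 2 is [false]; [~~ j] is the other one.
   [bool] carries the discrete sigma-algebra in the library. *)
Definition facility : Type := bool.

HB.instance Definition _ (R : realType) :=
  isPointed.Build {i01 R} (0%:i01 : {i01 R}).

Definition plain_outcome (R : realType) : Type := (bool * {i01 R})%type.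

Definition outcome_val (R : realType) (o : plain_outcome R) : bool * R :=
  (o.1, o.2%:num).

(* Outcomes are pairs (j, y) in {1,2} x [0,1], with the trace of the product
   of the discrete sigma-algebra and the Borel sigma-algebra of R. *)
Notation outcome R := (g_sigma_algebra_preimageType (@outcome_val R)).

Section Model.
Context {R : realType} {N : finType}.

Record instance := Instance {
  position : N -> {i01 R} ;
  approves : N -> facility -> bool ;
  approves_some : forall i, exists j, approves i j }.

Definition utility (I : instance) (i : N) (o : outcome R) : R :=
  (approves I i o.1)%:R * (1 - `|(position I i)%:num - o.2%:num|).

Definition welfare (I : instance) (o : outcome R) : R :=
  \sum_(i : N) utility I i o.

(* This supremum is a maximum: see [opt_welfareP]. *)
Definition opt_welfare (I : instance) : R := sup (range (welfare I)).

Lemma opt_welfareP (I : instance) :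
  (exists o, welfare I o = opt_welfare I) /\
  (forall o, welfare I o <= opt_welfare I).
Proof.
pose g (j : facility) (y : R) : R :=
  \sum_i (approves I i j)%:R * (1 - `|(position I i)%:num - y|).
have gc j : continuous (g j).
  apply: continuous_big; first exact: add_continuous.
  move=> i _ y; apply: cvgM; first exact: cvg_cst.
  apply: cvgB; first exact: cvg_cst.
  by apply: cvg_norm; apply: cvgB; [exact: cvg_cst|exact: cvg_id].
have best j : exists c : {i01 R}, forall y : {i01 R}, g j y%:num <= g j c%:num.
  have [c] := @EVT_max R (g j) 0 1 ler01 (continuous_subspaceT (gc j)).
  rewrite in_itv /= => /andP[c0 c1] cmax.
  exists (Itv01 c0 c1) => y; apply: cmax.
  by rewrite in_itv /= ge0 le1.
move: (best true) (best false) => [c1 max1] [c2 max2].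
have [b bmax] : exists o : outcome R, forall o', welfare I o' <= welfare I o.
  have [le21|/ltW le12] := leP (g false c2%:num) (g true c1%:num).
  - exists (true, c1) => -[[] y]; first exact: max1.
    exact: le_trans (max2 y) le21.
  - exists (false, c2) => -[[] y]; last exact: max2.
    exact: le_trans (max1 y) le12.
have ub : has_sup (range (welfare I)).
  split; first by exists (welfare I b), b.
  by exists (welfare I b) => _ [b' _ <-].
have le_opt o' : welfare I o' <= opt_welfare I.
  by apply: ub_le_sup; [exact: ub.2|exists o'].
split=> //; exists b; apply/eqP; rewrite eq_le le_opt /=.
by apply: ge_sup => [|_ [b' _ <-]]; [exact: ub.1|exact: bmax].
Qed.

Definition det_mechanism : Type := instance -> outcome R.

Definition rand_mechanism : Type := instance -> probability (outcome R) R.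

Definition expected_welfare (M : rand_mechanism) (I : instance) : \bar R :=
  (\int[M I]_o (welfare I o)%:E)%E.

(* In [\bar R], division by 0 gives +oo for a positive numerator. *)
Definition approx_ratio (M : rand_mechanism) : \bar R :=
  ereal_sup (range (fun I => ((opt_welfare I)%:E / expected_welfare M I)%E)).

(* [I'] is a joint misreport of positions by [S] at [I]: preferences are
   public, hence the same in [I] and [I']. *)
Definition misreport (S : {set N}) (I I' : instance) : Prop :=
  approves I' = approves I /\
  (forall i, i \notin S -> position I' i = position I i).

Definition group_strategyproof (D : det_mechanism) : Prop :=
  forall (I I' : instance) (S : {set N}), S != finset.set0 ->
    misreport S I I' ->
    ~ (forall i, i \in S -> utility I i (D I) < utility I i (D I')).

(* A distribution over deterministic mechanisms is given by a random variable
   [D] on some probability space [Omega]; the draw does not depend on the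
   instance. *)
Definition universally_group_strategyproof (M : rand_mechanism) : Prop :=
  exists (d : measure_display) (Omega : measurableType d)
         (P : probability Omega R) (D : Omega -> det_mechanism),
    (forall w, group_strategyproof (D w)) /\
    (forall I : instance,
       measurable_fun setT (fun w => D w I) /\
       forall A, measurable A -> M I A = pushforward P (fun w => D w I) A).

End Model.

Arguments instance : clear implicits.
Arguments det_mechanism : clear implicits.
Arguments rand_mechanism : clear implicits.

Section Mirror.
Context {R : realType} {N : finType}.
(* Conventions fixed once and for all, for each facility: which of the two
   middle agents to use (the right one iff [right j]), and the location used
   if nobody approves the facility. *)
Variables (right : facility -> bool) (y0 : facility -> {i01 R}).

Definition approvers (I : instance R N) (j : facility) : {set N} :=
  [set i | approves I i j]%SET.

Definition sorted_positions (I : instance R N) (j : facility) : seq {i01 R} :=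
  sort <=%O [seq position I i | i <- enum (approvers I j)].

Definition median (I : instance R N) (j : facility) : {i01 R} :=
  let n := #|approvers I j| in
  nth (y0 j) (sorted_positions I j) (if right j then n./2 else n.-1./2).

Definition alpha (n1 n2 : nat) : R :=
  (3 * n1%:R - 2 * n2%:R) / (4 * n1%:R - 2 * n2%:R).

Definition prob_facility1 (I : instance R N) : R :=
  let n1 := #|approvers I true| in
  let n2 := #|approvers I false| in
  if (n2 <= n1)%N then alpha n1 n2 else 1 - alpha n2 n1.

Definition mirror_outcome (I : instance R N) (j : bool) : outcome R :=
  (j, median I j).

Lemma measurable_mirror_outcome (I : instance R N) :
  measurable_fun setT (mirror_outcome I).
Proof. by []. Qed.

HB.instance Definition _ (I : instance R N) :=
  isMeasurableFun.Build _ _ _ _ (mirror_outcome I)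
    (measurable_mirror_outcome I).

(* The law of (j, median I j) when j = 1 with probability [prob_facility1 I]
   and j = 2 otherwise. *)
Definition mirror : rand_mechanism R N := fun I =>
  distribution (bernoulli_prob (prob_facility1 I)) (mirror_outcome I).

Lemma prob_facility1_itv (I : instance R N) : 0 <= prob_facility1 I <= 1.
Proof.
have alpha_itv (n1 n2 : nat) : (n2 <= n1)%N -> 0 <= alpha n1 n2 <= 1.
  rewrite /alpha -(ler_nat R) => le21.
  have n2_ge0 : 0 <= n2%:R :> R by [].
  have [n1_0|n1_neq0] := eqVneq (n1%:R : R) 0.
    have -> : n2%:R = 0 :> R by lra.
    by rewrite n1_0 !mulr0 subr0 mul0r lexx ler01.
  have n1_gt0 : 0 < n1%:R :> R by rewrite lt_def n1_neq0 /=.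
  have den_gt0 : 0 < 4 * n1%:R - 2 * n2%:R :> R by lra.
  by rewrite divr_ge0 ?ler_pdivrMr //=; lra.
rewrite /prob_facility1; case: ifPn => [/alpha_itv //|].
by rewrite -ltnNge => /ltnW /alpha_itv; lra.
Qed.

Lemma mirrorE (I : instance R N) (A : set (outcome R)) :
  (mirror I A = (prob_facility1 I)%:E * \d_(mirror_outcome I true) A +
                (1 - prob_facility1 I)%:E * \d_(mirror_outcome I false) A)%E.
Proof.
rewrite /mirror /= /distribution /pushforward.
by rewrite bernoulli_probE ?prob_facility1_itv // !diracE !mem_preimage.
Qed.

End Mirror.

(* Main.v *)
(* A coalition can move a median to the left only if it contains an agent that
   stands at the median or to its right, and this agent loses; the choice of the
   facility depends only on the public preferences. Hence, for every
   threshold [w] in [0, 1], "facility 1 iff [w < p], at its median" is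
   group-strategyproof, and a uniform [w] gives the Mirror mechanism.

   For the ratio, the medians maximise the welfare of each facility, and their
   welfares satisfy [n_j / 2 <= w_j <= n_j] (compare with the location 1/2).
   Up to a positive factor, [alpha w_1 + (1 - alpha) w_2 - 3/4 w_1] is
   [2 w_2 n_1 - n_2 w_1 >= 0], while [alpha w_1 + (1 - alpha) w_2 - 3/4 w_2] is
   at least [3/2 (n_1 - n_2)^2]. The ratio 4/3 is attained when all agents stand
   at 0 and approve only facility 1. *)
From HB Require Import structures.
Require Import Defs.
From mathcomp Require Import all_boot all_order all_algebra.
From mathcomp Require Import all_classical all_reals all_analysis.
From mathcomp Require Import measurable_realfun.
From mathcomp Require Import ring lra zify.

Set Implicit Arguments.
Unset Strict Implicit.
Unset Printing Implicit Defensive.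

Import Order.TTheory GRing.Theory Num.Theory.

Local Open Scope ring_scope.

(** * Order statistics of a finite family, with ranks counted from 0 *)

Section OrderStatistic.
Context {disp : Order.disp_t} {T : orderType disp} {N : finType}.
Variables (d : T) (A : {set N}).
Implicit Types (x : N -> T) (k : nat) (z : T).

Definition order_statistic x k : T :=
  nth d (sort <=%O [seq x i | i <- enum A]) k.

Let count_sorted (p : pred T) x :
  count p (sort <=%O [seq x i | i <- enum A]) = #|[set i in A | p (x i)]%SET|.
Proof.
rewrite count_sort count_map cardE -size_filter /enum_mem -filter_predI.
by congr size; apply: eq_filter => i; rewrite !inE andbC.
Qed.

Let sorted_sort x : sorted <=%O (sort <=%O [seq x i | i <- enum A]).
Proof. exact/sort_sorted/le_total. Qed.

Let size_sorted x : size (sort <=%O [seq x i | i <- enum A]) = #|A|.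
Proof. by rewrite size_sort size_map cardE. Qed.

Lemma order_statistic_le x k z :
  (k < #|[set i in A | (x i <= z)%O]%SET|)%N -> (order_statistic x k <= z)%O.
Proof. by move=> kz; rewrite nth_count_le// count_sorted. Qed.

Lemma order_statistic_ge x k z :
  (#|[set i in A | (x i < z)%O]%SET| <= k < #|A|)%N ->
  (z <= order_statistic x k)%O.
Proof.
by move=> kz; rewrite DualTotalTheory.nth_count_ge// count_sorted size_sorted.
Qed.

(** If at most [k] points lay at or below the value of rank [k], that value would be greater than
    itself. *)
Lemma card_le_order_statistic x k : (k < #|A|)%N ->
  (k < #|[set i in A | (x i <= order_statistic x k)%O]%SET|)%N.
Proof.
move=> kA; rewrite ltnNge; apply/negP => kle.
suff : (order_statistic x k < order_statistic x k)%O by rewrite ltxx.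
rewrite {2}/order_statistic DualTotalTheory.nth_count_gt//.
by rewrite count_sorted size_sorted kle.
Qed.

Lemma card_lt_order_statistic x k :
  (#|[set i in A | (x i < order_statistic x k)%O]%SET| <= k)%N.
Proof.
rewrite leqNgt; apply/negP => klt.
suff : (order_statistic x k < order_statistic x k)%O by rewrite ltxx.
by rewrite {1}/order_statistic nth_count_lt// count_sorted.
Qed.

(** At most [k] points of [x] lie strictly below its value of rank [k]. By hypothesis the points of
    [x'] strictly below that value are among the same agents, so the bound passes to [x']. *)
Lemma order_statistic_shift_right x x' k : (k < #|A|)%N ->
  (forall i, i \in A -> (x' i < order_statistic x k)%O ->
     (x i < order_statistic x k)%O) ->
  (order_statistic x k <= order_statistic x' k)%O.
Proof.
move=> kA sub; apply: order_statistic_ge; rewrite kA andbT.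
apply: leq_trans (card_lt_order_statistic x k).
apply/subset_leq_card/fintype.subsetP => i; rewrite !inE => /andP[iA x'i].
by rewrite iA sub.
Qed.

Lemma order_statistic_shift_left x x' k : (k < #|A|)%N ->
  (forall i, i \in A -> (x i <= order_statistic x k)%O ->
     (x' i <= order_statistic x k)%O) ->
  (order_statistic x' k <= order_statistic x k)%O.
Proof.
move=> kA sub; apply: order_statistic_le.
apply: (leq_trans (card_le_order_statistic x kA)).
apply/subset_leq_card/fintype.subsetP => i; rewrite !inE => /andP[iA xi].
by rewrite iA sub.
Qed.

End OrderStatistic.

(** * Medians: incentives, optimality, expected welfare *)

Section Median.
Context {R : realType} {N : finType}.
Variables (right : facility -> bool) (y0 : facility -> {i01 R}).
Implicit Types (I : instance R N) (j : facility).

Local Notation median := (median right y0).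

Definition median_rank I j : nat :=
  let n := #|approvers I j| in if right j then n./2 else n.-1./2.

Lemma medianE I j :
  median I j = order_statistic (y0 j) (approvers I j) (position I)
                 (median_rank I j).
Proof. by []. Qed.

(** Both choices of middle agent satisfy these bounds: at most half of the approvers are strictly
    left of the median, and at least half are at or left of it. *)
Lemma median_rankP I j : (0 < #|approvers I j|)%N ->
  [/\ (median_rank I j < #|approvers I j|)%N,
      (2 * median_rank I j <= #|approvers I j|)%N &
      (#|approvers I j| <= 2 * (median_rank I j).+1)%N].
Proof. by rewrite /median_rank; case: (right j); split; lia. Qed.

Lemma welfareE I j (y : {i01 R}) : welfare I (j, y) =
  \sum_(i in approvers I j) (1 - `|(position I i)%:num - y%:num|).
Proof.
rewrite /welfare [RHS]big_mkcond; apply: eq_bigr => i _.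
by rewrite /utility inE /=; case: (approves I i j); rewrite ?mul1r ?mul0r.
Qed.

Lemma group_strategyproof_median (c : instance R N -> facility) :
  (forall I I', approves I' = approves I -> c I' = c I) ->
  group_strategyproof (fun I => mirror_outcome right y0 I (c I)).
Proof.
move=> c_approves I I' S /set0Pn[i0 i0S] [eq_approves eq_position].
rewrite (c_approves _ _ eq_approves); move: (c I) => j better.
have eqA : approvers I' j = approvers I j by rewrite /approvers eq_approves.
(* A non-approver has utility 0 at both outcomes, so a strict gain forces approval and a strictly
   smaller distance. *)
have betterE i : i \in S -> i \in approvers I j /\
    `|(position I i)%:num - (median I' j)%:num| <
    `|(position I i)%:num - (median I j)%:num|.
  move=> /better; rewrite /utility inE /=.
  case: (approves I i j); last by rewrite !mul0r ltxx.
  by rewrite !mul1r ltrD2l ltrN2.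
have A_gt0 : (0 < #|approvers I j|)%N.
  by apply/card_gt0P; exists i0; case: (betterE _ i0S).
have [kn _ _] := median_rankP A_gt0.
have medianI' : median I' j = order_statistic (y0 j) (approvers I j)
    (position I') (median_rank I j) by rewrite medianE /median_rank eqA.
(* If the median moved left, every gaining member would truly stand strictly left of the old median,
   and such members cannot pull it left by misreporting. A move to the right is symmetric. *)
have [lt_m|gt_m|eq_m] := ltgtP (median I' j) (median I j).
- suff : median I j <= median I' j by rewrite leNgt lt_m.
  rewrite medianI' medianE; apply: order_statistic_shift_right => // i _.
  rewrite -medianE; have [/betterE[_ +] _|iS] := boolP (i \in S).
    move=> near_m'; rewrite ltNge; apply/negP => xm.
    move: near_m' lt_m xm; rewrite ltNge -num_lt -num_le /= => + lt_m xm.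
    move=> /negP[].
    by rewrite !ger0_norm ?subr_ge0 ?(le_trans (ltW lt_m))//; lra.
  by rewrite eq_position.
- suff : median I' j <= median I j by rewrite leNgt gt_m.
  rewrite medianI' medianE; apply: order_statistic_shift_left => // i _.
  rewrite -medianE; have [/betterE[_ +]|iS] := boolP (i \in S).
    move=> + xm; rewrite ltNge => /negP[].
    move: gt_m xm; rewrite -num_lt -num_le /= => gt_m xm.
    by rewrite !ler0_norm ?subr_le0 ?(le_trans xm (ltW gt_m))//; lra.
  by rewrite eq_position.
- by have [_] := betterE _ i0S; rewrite eq_m ltxx.
Qed.

(* Moving from [m] to the right by [y - m] brings every point at or left of [m]
   farther by [y - m], and any other point closer by at most [y - m]. *)
Lemma sum_dist_ge (A : {set N}) (x : N -> R) (m y : R) : m <= y ->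
  (#|A| <= 2 * #|[set i in A | (x i <= m)%R]%SET|)%N ->
  \sum_(i in A) `|x i - m| <= \sum_(i in A) `|x i - y|.
Proof.
move=> my hA; rewrite -subr_ge0 -sumrB.
have cardE : #|[set i in A | (x i <= m)%R]%SET| =
    (\sum_(i in A) (x i <= m)%R)%N.
  rewrite -sum1_card big_mkcond [RHS]big_mkcond; apply: eq_bigr => i _.
  by rewrite !inE; case: (i \in A); case: (_ <= m).
apply: (@le_trans _ _ (\sum_(i in A) (y - m) * (2 * (x i <= m)%R%:R - 1))).
  rewrite -mulr_sumr mulr_ge0 ?subr_ge0// sumrB -mulr_sumr sumr_const.
  by rewrite subr_ge0 -natr_sum -natrM ler_nat -cardE.
apply: ler_sum => i _; case: (leP (x i) m) => xm.
  by rewrite !ler0_norm ?subr_le0 ?(le_trans xm)//=; lra.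
have := ler_norm (y - x i); have := ler_norm (x i - y).
by rewrite (distrC y) (@ger0_norm _ (x i - m)) /=; lra.
Qed.

Lemma median_optimal I j (y : {i01 R}) :
  welfare I (j, y) <= welfare I (j, median I j).
Proof.
rewrite !welfareE !sumrB lerB//.
have [A0|A_gt0] := posnP #|approvers I j|.
  by rewrite (cards0_eq A0) !big_set0.
have [kn nk1 nk2] := median_rankP A_gt0.
have [my|/ltW ym] := leP (median I j) y.
  apply: (sum_dist_ge (x := fun i => (position I i)%:num)); first exact: my.
  apply: leq_trans nk2 _; rewrite leq_mul2l /=.
  exact: (card_le_order_statistic (y0 j) (position I) kn).
have oppE (z : {i01 R}) :
    \sum_(i in approvers I j) `|(position I i)%:num - z%:num| =
    \sum_(i in approvers I j) `|- (position I i)%:num - - z%:num|.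
  by apply: eq_bigr => i _; rewrite -opprD normrN.
(* For [y] left of the median, reflect all points through 0 and reuse the case of a move to the
   right. *)
rewrite !oppE.
apply: (sum_dist_ge (x := fun i => - (position I i)%:num)).
  by rewrite lerN2; exact: ym.
(* After reflection, the points at or left of the median are the approvers outside [L]; [L] contains
   at most half of the approvers. *)
pose L := [set i | (position I i < median I j)%O]%SET.
have -> : [set i in approvers I j |
    (- (position I i)%:num <= - (median I j)%:num)%R]%SET = approvers I j :\: L.
  by apply/setP => i; rewrite !inE lerN2 -leNgt andbC.
have : (#|approvers I j :&: L| <= median_rank I j)%N.
  by rewrite -setIdE; exact: card_lt_order_statistic.
have := cardsID L (approvers I j).
lia.
Qed.

Lemma welfare_median_ge I j :
  #|approvers I j|%:R / 2 <= welfare I (j, median I j).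
Proof.
have half_ge0 : 0 <= 2^-1 :> R by lra.
have half_le1 : 2^-1 <= 1 :> R by lra.
apply: le_trans (median_optimal I j (Itv01 half_ge0 half_le1)).
rewrite welfareE -mulr_natl mulr1 -sum1_card natr_sum mulr_suml.
apply: ler_sum => i _ /=.
have x_ge0 : 0 <= (position I i)%:num by [].
have x_le1 : (position I i)%:num <= 1 by [].
have : `|(position I i)%:num - 2^-1| <= 2^-1 by rewrite ler_norml; lra.
lra.
Qed.

Lemma welfare_le_approvers I j (y : {i01 R}) :
  welfare I (j, y) <= #|approvers I j|%:R.
Proof.
rewrite welfareE -sum1_card natr_sum; apply: ler_sum => i _.
by rewrite gerBl.
Qed.

Lemma opt_welfare_le I :
  opt_welfare I <=
    Num.max (welfare I (true, median I true))
            (welfare I (false, median I false)).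
Proof.
have [[[j y] <-] _] := opt_welfareP I; rewrite le_max.
by case: j; rewrite !median_optimal ?orbT.
Qed.

Lemma measurable_welfare I : measurable_fun setT (welfare I).
Proof.
(* The sigma-algebra on outcomes consists of preimages under [outcome_val], so [B] itself is the
   witness. *)
have mval : measurable_fun setT (@outcome_val R : outcome R -> bool * R).
  by move=> _ B mB; rewrite setTI; exists B => //; rewrite setTI.
apply: measurable_sum => i; apply: measurable_funM.
  have mapproves :
    measurable_fun setT (fun j : bool => (approves I i j)%:R : R) by [].
  exact: (measurableT_comp mapproves (measurableT_comp measurable_fst mval)).
apply: measurable_funB => //; apply: measurableT_comp => //.
apply: measurable_funB => //.
exact: (measurableT_comp measurable_snd mval).
Qed.

Lemma utility_ge0 I i (o : outcome R) : 0 <= utility I i o.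
Proof.
rewrite mulr_ge0// subr_ge0 ler_norml.
have x_ge0 : 0 <= (position I i)%:num by [].
have x_le1 : (position I i)%:num <= 1 by [].
have y_ge0 : 0 <= o.2%:num by [].
have y_le1 : o.2%:num <= 1 by [].
lra.
Qed.

Lemma expected_welfare_mirror I :
  (expected_welfare (mirror right y0) I =
   (prob_facility1 I * welfare I (true, median I true) +
    (1 - prob_facility1 I) * welfare I (false, median I false))%:E)%E.
Proof.
have W_ge0 o : 0 <= welfare I o by apply: sumr_ge0 => i _; exact: utility_ge0.
rewrite /expected_welfare ge0_integral_distribution; last 2 first.
- exact/measurable_EFinP/measurable_welfare.
- by move=> o; rewrite lee_fin.
by rewrite integral_bernoulli_prob ?prob_facility1_itv// => j; rewrite lee_fin.
Qed.

End Median.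

(** * The upper bound 4/3 *)

Lemma mirror_bound (R : realType) (n1 n2 : nat) (w1 w2 : R) :
  (0 < n1)%N -> (n2 <= n1)%N ->
  n1%:R / 2 <= w1 <= n1%:R -> n2%:R / 2 <= w2 <= n2%:R ->
  Num.max w1 w2 <= 4 / 3 * (alpha n1 n2 * w1 + (1 - alpha n1 n2) * w2).
Proof.
rewrite -(ltr_nat R) -(ler_nat R) /alpha; have := ler0n R n2.
move: (n1%:R : R) (n2%:R : R) => a b b_ge0 a_gt0 ba.
move=> /andP[w1l w1u] /andP[w2l w2u].
have D_gt0 : 0 < 4 * a - 2 * b by lra.
have -> : 4 / 3 * ((3 * a - 2 * b) / (4 * a - 2 * b) * w1 +
    (1 - (3 * a - 2 * b) / (4 * a - 2 * b)) * w2) =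
  4 * ((3 * a - 2 * b) * w1 + a * w2) / (3 * (4 * a - 2 * b)).
  by field; rewrite gt_eqF.
have D3_gt0 : 0 < 3 * (4 * a - 2 * b) by lra.
rewrite ge_max !ler_pdivlMr//; apply/andP; split.
(* Equivalent to [b * w1 <= 2 * a * w2], which follows from [w1 <= a] and [b <= 2 * w2]. *)
- nra.
(* Equivalent to [(8 * a - 6 * b) * w2 <= (12 * a - 8 * b) * w1]. Both coefficients are nonnegative,
   so the extreme case is [w2 = b], [w1 = a / 2], where the gap is [6 * (a - b) ^ 2]. *)
- nra.
Qed.

Lemma mirror_welfare (R : realType) (N : finType) (right : facility -> bool)
    (y0 : facility -> {i01 R}) (I : instance R N) : (0 < #|N|)%N ->
  exists2 w : R, 0 < w /\ opt_welfare I <= 4 / 3 * w &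
    expected_welfare (mirror right y0) I = w%:E.
Proof.
move=> N_gt0; rewrite expected_welfare_mirror; eexists; last by [].
set w1 := welfare I (true, _); set w2 := welfare I (false, _).
have w1P : #|approvers I true|%:R / 2 <= w1 <= #|approvers I true|%:R.
  by rewrite welfare_median_ge welfare_le_approvers.
have w2P : #|approvers I false|%:R / 2 <= w2 <= #|approvers I false|%:R.
  by rewrite welfare_median_ge welfare_le_approvers.
have n_gt0 : (0 < maxn #|approvers I true| #|approvers I false|)%N.
  have /card_gt0P[i _] := N_gt0; have [j ij] := approves_some I i.
  have j_gt0 : (0 < #|approvers I j|)%N.
    by apply/card_gt0P; exists i; rewrite inE.
  by case: j {ij} j_gt0 => ?; rewrite leq_max; apply/orP; [left|right].
set w := (X in 0 < X /\ _).
have le_w : Num.max w1 w2 <= 4 / 3 * w.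
  rewrite /w /prob_facility1; case: leqP => n12.
    by apply: mirror_bound => //; rewrite (maxn_idPl n12) in n_gt0.
  rewrite [X in 4 / 3 * X](_ : _ =
    alpha #|approvers I false| #|approvers I true| * w2 +
    (1 - alpha #|approvers I false| #|approvers I true|) * w1); last ring.
  rewrite maxC; apply: mirror_bound => //; last exact: ltnW.
  exact: leq_trans n12.
split; last exact: le_trans (opt_welfare_le right y0 I) le_w.
(* Some facility has an approver, hence positive welfare at its median; with [le_w] this makes [w]
   positive. *)
have max_gt0 : 0 < Num.max w1 w2.
  rewrite lt_max; move: n_gt0; rewrite leq_max -!(ltr_nat R).
  by case/orP => ?; apply/orP; [left|right]; lra.
lra.
Qed.

(** * A Bernoulli draw from a uniform threshold *)

Section Threshold.
Local Open Scope classical_set_scope.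
Context {R : realType}.

Definition below (p : R) (w : measurableTypeR R) : bool := (w : R) < p.

Lemma measurable_below (p : R) : measurable_fun setT (below p).
Proof. exact: measurable_fun_ltr. Qed.

HB.instance Definition _ (p : R) :=
  isMeasurableFun.Build _ _ (measurableTypeR R) _ (below p)
    (measurable_below p).

(** A law on Booleans is determined by the mass of [true], here the length of [[0, p[]. *)
Lemma below_bernoulli (p : R) : 0 <= p <= 1 ->
  distribution (uniform_prob (@ltr01 R)) (below p) =1 bernoulli_prob p.
Proof.
move=> /andP[p0 p1]; apply: eq_bernoulli.
rewrite /distribution /pushforward /= /uniform_prob integral_uniform_pdf.
rewrite (_ : _ `&` _ = `[0, p[); last first.
  apply/seteqP; split => x /=; rewrite !in_itv /= /below.
    by move=> [-> /andP[-> _]].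
  by move=> /andP[-> xp]; rewrite xp (le_trans (ltW xp)).
rewrite (eq_integral (fun=> 1%:E)); last first.
  move=> x; rewrite inE/= in_itv/= /uniform_pdf => /andP[-> xp].
  by rewrite (le_trans (ltW xp))// subr0 invr1.
rewrite integral_cst//= mul1e lebesgue_measure_itv/= lte_fin.
by case: ltgtP p0 => // [p_gt0|<-] _; rewrite ?oppr0 ?adde0.
Qed.

End Threshold.

Lemma mirror_universally_gsp (R : realType) (N : finType)
    (right : facility -> bool) (y0 : facility -> {i01 R}) :
  universally_group_strategyproof (mirror right y0 : rand_mechanism R N).
Proof.
exists _, _, (uniform_prob (@ltr01 R)),
  (fun w I => mirror_outcome right y0 I (below (prob_facility1 I) w)).
split=> [w|I].
  apply: group_strategyproof_median => I I' eq_approves.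
  by rewrite /prob_facility1 /approvers eq_approves.
split=> [|A mA].
  exact: measurableT_comp (measurable_mirror_outcome _ _ _)
           (measurable_below _).
(* Both sides evaluate a law on Booleans at the preimage of [A] under [mirror_outcome], and the two
   laws agree. *)
exact/esym/below_bernoulli/prob_facility1_itv.
Qed.

Lemma mirror_approx_ratio (R : realType) (N : finType)
    (right : facility -> bool) (y0 : facility -> {i01 R}) : (0 < #|N|)%N ->
  approx_ratio (mirror right y0 : rand_mechanism R N) = (4 / 3 : R)%:E.
Proof.
move=> N_gt0; apply/eqP; rewrite eq_le; apply/andP; split.
  apply: ge_ereal_sup => _ [I _ <-].
  have [w [w_gt0 le_w] ->] := mirror_welfare right y0 I N_gt0.
  by rewrite inver gt_eqF// -EFinM lee_fin ler_pdivrMr.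
pose only1 (_ : N) (j : facility) : bool := j.
have only1_some i : exists j, only1 i j by exists true.
pose zero : {i01 R} := Itv01 (lexx 0) ler01.
pose I : instance R N := Instance (fun=> zero) only1_some.
have approversE j : approvers I j = if j then [set: N]%SET else finset.set0.
  by apply/setP => i; case: j; rewrite !inE.
have n_gt0 : 0 < #|N|%:R :> R by rewrite ltr0n.
have W1 (y : {i01 R}) : welfare I (true, y) = #|N|%:R * (1 - y%:num).
  rewrite welfareE approversE (eq_bigr (fun=> 1 - y%:num)).
    by rewrite sumr_const cardsT mulr_natl.
  by move=> i _; rewrite /= sub0r normrN ger0_norm.
have W2 (y : {i01 R}) : welfare I (false, y) = 0.
  by rewrite welfareE approversE big_set0.
have pE : prob_facility1 I = 3 / 4.
  rewrite /prob_facility1 !approversE cards0 cardsT leq0n /alpha.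
  by field; rewrite gt_eqF.
have opt_ge : #|N|%:R <= opt_welfare I.
  by have [_ /(_ (true, zero))] := opt_welfareP I; rewrite W1 /= subr0 mulr1.
apply: le_trans (ereal_sup_ubound _); last by exists I.
have [w [w_gt0 _] wE] := mirror_welfare right y0 I N_gt0.
rewrite wE inver gt_eqF// -EFinM lee_fin ler_pdivlMr//.
(* The median need not be computed: any location in [0, 1] gives [w] at most 3/4 of [#|N|]. *)
have -> : w = 3 / 4 * (#|N|%:R * (1 - (median right y0 I true)%:num)).
  by move: wE; rewrite expected_welfare_mirror W1 W2 pE mulr0 addr0 => -[].
have : 0 <= #|N|%:R * (median right y0 I true)%:num by rewrite mulr_ge0.
by rewrite mulrBr; lra.
Qed.

Theorem theorem4p4 (R : realType) (N : finType) (right : facility -> bool)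
    (y0 : facility -> {i01 R}) (hN : (0 < #|N|)%N) :
  universally_group_strategyproof (mirror right y0 : rand_mechanism R N) /\
  approx_ratio (mirror right y0 : rand_mechanism R N) = ((4 / 3 : R)%:E)%E.
Proof.
split; [exact: mirror_universally_gsp|exact: mirror_approx_ratio].
Qed.
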